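(* The category of abelian quandles (with quandle homomorphisms as morphisms) is symmetric monoidal closed under the tensor product $\otimes$ (with unit the one-element quandle) and the closed structure $\mathbf{Hom}(-,-)$, where $\otimes$ and $\mathbf{Hom}$ are as defined in the context; that is, $\otimes$ makes it a symmetric monoidal category in which, for every abelian quandle $Q$, the functor $-\otimes Q$ has right adjoint $\mathbf{Hom}(Q,-)$.
   Context: A quandle is a set $X$ with a binary operation $\triangleright:X\times X\to X$ such that (i) $x\triangleright x=x$ for all $x\in X$; (ii) for all $x,y\in X$ there is a unique $z\in X$ with $x=z\triangleright y$; (iii) $(x\triangleright y)\triangleright z=(x\triangleright z)\triangleright(y\triangleright z)$ for all $x,y,z\in X$. A quandle homomorphism $f:X\to Y$ is a map with $f(x\triangleright y)=f(x)\triangleright f(y)$ for all $x,y\in X$. A quandle $X$ is abelian (also called medial) if $(x\triangleright y)\triangleright(z\triangleright w)=(x\triangleright z)\triangleright(y\triangleright w)$ for all $x,y,z,w\in X$. For abelian quandles $Q$ and $A$, $\mathbf{Hom}(Q,A)$ denotes the set of quandle homomorphisms $Q\to A$ with the pointwise operation $(f\triangleright g)(q)=f(q)\triangleright g(q)$; it is an abelian quandle. For abelian quandles $Q$ and $A$, the tensor product $Q\otimes A$ is the free abelian quandle on the set $Q\times A$ quotiented out by the relations $(q,a_1)\triangleright(q,a_2)=(q,a_1\triangleright a_2)$ and $(q_1,a)\triangleright(q_2,a)=(q_1\triangleright q_2,a)$ for $q,q_1,q_2\in Q$ and $a,a_1,a_2\in A$. Thus for abelian quandles $X$, homomorphisms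 $Q\otimes A\to X$ correspond to bihomomorphisms, i.e. functions $f:Q\times A\to X$ such that $f(q,-):A\to X$ and $f(-,a):Q\to X$ are homomorphisms for each $q\in Q$ and each $a\in A$. A symmetric monoidal category $C$ is closed if for every object $Q$ the functor $-\otimes Q:C\to C$ has a right adjoint. *)

(* Defs.v *)
From mathcomp Require Import all_boot generic_quotient boolp.

Set Implicit Arguments.
Unset Strict Implicit.
Unset Printing Implicit Defensive.

Declare Scope quandle_scope.
Delimit Scope quandle_scope with Qd.
Local Open Scope quandle_scope.

Record quandle := Quandle {
  qcar :> Type;
  qop : qcar -> qcar -> qcar;
  qopxx : forall x, qop x x = x;
  qop_div : forall x y, exists! z, x = qop z y;
  qopD : forall x y z, qop (qop x y) z = qop (qop x z) (qop y z) }.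

Notation "x |> y" := (qop x y) (at level 40, left associativity) : quandle_scope.

Record aquandle := AQuandle {
  aq_quandle :> quandle;
  qopACA : forall x y z w : aq_quandle,
    (x |> y) |> (z |> w) = (x |> z) |> (y |> w) }.

Record qhom (X Y : quandle) := QHom {
  qfun :> X -> Y;
  qfunM : forall x y, qfun (x |> y) = qfun x |> qfun y }.

Lemma qhom_eq (X Y : quandle) (f g : qhom X Y) : f =1 g -> f = g.
Proof.
case: f g => [f fM] [g gM] /= /funext fg; case: _ / fg in gM *.
by rewrite (Prop_irrelevance fM gM).
Qed.

Definition qhom_id (X : quandle) : qhom X X := @QHom X X id (fun _ _ => erefl).

Lemma qhom_comp_subproof (X Y Z : quandle) (g : qhom Y Z) (f : qhom X Y) x y :
  g (f (x |> y)) = g (f x) |> g (f y).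
Proof. by rewrite !qfunM. Qed.

Definition qhom_comp (X Y Z : quandle) (g : qhom Y Z) (f : qhom X Y) : qhom X Z :=
  QHom (qhom_comp_subproof g f).

Definition qdiv (X : quandle) (x y : X) : X := projT1 (cid (qop_div x y)).

Lemma qdivK (X : quandle) (x y : X) : qdiv x y |> y = x.
Proof. by rewrite /qdiv; case: cid => z [/= <-]. Qed.

Lemma qopI (X : quandle) (y z z' : X) : z |> y = z' |> y -> z = z'.
Proof.
by move=> e; have [u [_ uP]] := qop_div (z |> y) y; rewrite -(uP z) // (uP z').
Qed.

Lemma qopK (X : quandle) (x y : X) : qdiv (x |> y) y = x.
Proof. by apply: (@qopI _ y); rewrite qdivK. Qed.

Lemma unit_div (x y : unit) : exists! z : unit, x = tt.
Proof. by exists tt; split=> [|[]]; case: x. Qed.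

Definition unit_quandle : quandle :=
  @Quandle unit (fun _ _ => tt) (fun x => let: tt := x in erefl) unit_div
    (fun _ _ _ => erefl).

Definition unit_aq : aquandle := @AQuandle unit_quandle (fun _ _ _ _ => erefl).

Section InternalHom.
Variables Q A : aquandle.

Lemma hom_op_subproof (f g : qhom Q A) x y :
  f (x |> y) |> g (x |> y) = (f x |> g x) |> (f y |> g y).
Proof. by rewrite !qfunM qopACA. Qed.

Definition hom_op (f g : qhom Q A) : qhom Q A :=
  @QHom Q A (fun q => f q |> g q) (hom_op_subproof f g).

Lemma hom_opxx f : hom_op f f = f.
Proof. by apply: qhom_eq => q; apply: qopxx. Qed.

Lemma hom_op_div f g : exists! h, f = hom_op h g.
Proof.
have hM x y : qdiv (f (x |> y)) (g (x |> y))
    = qdiv (f x) (g x) |> qdiv (f y) (g y).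
  by apply: (@qopI _ (g (x |> y))); rewrite qdivK !qfunM qopACA !qdivK.
exists (@QHom Q A (fun q => qdiv (f q) (g q)) hM); split=> [|h fE].
  by apply: qhom_eq => q /=; rewrite qdivK.
by apply: qhom_eq => q /=; rewrite fE qopK.
Qed.

Lemma hom_opD f g h : hom_op (hom_op f g) h = hom_op (hom_op f h) (hom_op g h).
Proof. by apply: qhom_eq => q; apply: qopD. Qed.

Definition hom_quandle : quandle := Quandle hom_opxx hom_op_div hom_opD.

Lemma hom_opACA (f g h k : hom_quandle) :
  (f |> g) |> (h |> k) = (f |> h) |> (g |> k).
Proof. by apply: qhom_eq => q; apply: qopACA. Qed.

Definition hom_aq : aquandle := AQuandle hom_opACA.

End InternalHom.

Record equivalence T (e : T -> T -> Prop) : Prop := Equivalence {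
  eqv_refl : forall x, e x x;
  eqv_sym : forall x y, e x y -> e y x;
  eqv_trans : forall x y z, e x y -> e y z -> e x z }.

Section Quot.
Variables (T : Type) (e : T -> T -> Prop) (eP : equivalence e).

Definition erel : rel {classic T} := fun x y => `[< e x y >].

Lemma erel_refl : reflexive erel.
Proof. by move=> x; apply/asboolP; apply: eqv_refl eP x. Qed.

Lemma erel_sym : symmetric erel.
Proof. by move=> x y; apply/asboolP/asboolP; apply: eqv_sym eP _ _. Qed.

Lemma erel_trans : transitive erel.
Proof.
by move=> y x z /asboolP xy /asboolP yz; apply/asboolP; apply: eqv_trans eP _ _ _ xy yz.
Qed.

Definition quot_rel : equiv_rel {classic T} := EquivRel erel erel_refl erel_sym erel_trans.

Definition quot : Type := {eq_quot quot_rel}%qT.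

Definition cls (x : T) : quot := (\pi_{eq_quot quot_rel} (x : {classic T}))%qT.

Definition rep (c : quot) : T := repr (c : {eq_quot quot_rel}%qT).

Lemma clsP x y : cls x = cls y <-> e x y.
Proof.
by split=> [/eqmodP/asboolP //|xy]; apply/eqmodP; apply/asboolP.
Qed.

Lemma repK c : cls (rep c) = c.
Proof. exact: reprK. Qed.

Lemma rep_cls x : e (rep (cls x)) x.
Proof. by apply/clsP; rewrite repK. Qed.

End Quot.

Inductive qterm (S : Type) :=
  | tgen of S
  | top of qterm S & qterm S
  | tdiv of qterm S & qterm S.

(* [tdiv s t] is a formal solution z of z |> t = s. *)
Inductive teq (S : Type) : qterm S -> qterm S -> Prop :=
  | teq_refl s : teq s s
  | teq_sym s t : teq s t -> teq t s
  | teq_trans s t u : teq s t -> teq t u -> teq s u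
  | teq_top s s' t t' : teq s s' -> teq t t' -> teq (top s t) (top s' t')
  | teq_tdiv s s' t t' : teq s s' -> teq t t' -> teq (tdiv s t) (tdiv s' t')
  | teq_xx s : teq (top s s) s
  | teq_divK s t : teq (top (tdiv s t) t) s
  | teq_opK s t : teq (tdiv (top s t) t) s
  | teq_D s t u : teq (top (top s t) u) (top (top s u) (top t u))
  | teq_ACA s t u v :
      teq (top (top s t) (top u v)) (top (top s u) (top t v)).

Lemma teq_equivalence S : equivalence (@teq S).
Proof.
by split; [apply: teq_refl|apply: teq_sym|apply: teq_trans].
Qed.

Section Free.
Variable S : Type.

Definition free_car : Type := quot (teq_equivalence S).

Definition free_cls : qterm S -> free_car := cls (teq_equivalence S).

Definition free_op (x y : free_car) : free_car := free_cls (top (rep x) (rep y)).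

Lemma free_opE s t : free_op (free_cls s) (free_cls t) = free_cls (top s t).
Proof. by apply/clsP; apply: teq_top; apply: rep_cls. Qed.

Lemma free_ind (P : free_car -> Prop) : (forall s, P (free_cls s)) -> forall x, P x.
Proof. by move=> Pc x; rewrite -(repK x); apply: Pc. Qed.

Lemma free_opxx x : free_op x x = x.
Proof.
by elim/free_ind: x => s; rewrite free_opE; apply/clsP; apply: teq_xx.
Qed.

Lemma free_op_div x y : exists! z, x = free_op z y.
Proof.
elim/free_ind: x => s; elim/free_ind: y => t; exists (free_cls (tdiv s t)); split.
  by rewrite free_opE; apply/clsP; apply: teq_sym; apply: teq_divK.
elim/free_ind => u; rewrite free_opE => /clsP su; apply/clsP.
apply: teq_trans (teq_opK u t).
by apply: teq_tdiv; [apply: su|apply: teq_refl].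
Qed.

Lemma free_opD x y z :
  free_op (free_op x y) z = free_op (free_op x z) (free_op y z).
Proof.
elim/free_ind: x => s; elim/free_ind: y => t; elim/free_ind: z => u.
by rewrite !free_opE; apply/clsP; apply: teq_D.
Qed.

Definition free_quandle : quandle := Quandle free_opxx free_op_div free_opD.

Lemma free_opACA (x y z w : free_quandle) :
  (x |> y) |> (z |> w) = (x |> z) |> (y |> w).
Proof.
elim/free_ind: x => s; elim/free_ind: y => t; elim/free_ind: z => u.
elim/free_ind: w => v.
by rewrite /= !free_opE; apply/clsP; apply: teq_ACA.
Qed.

Definition free_aq : aquandle := AQuandle free_opACA.

Definition free_gen (s : S) : free_aq := free_cls (tgen s).

Variables (X : aquandle) (f : S -> X).

Fixpoint teval (t : qterm S) : X :=
  match t with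
  | tgen s => f s
  | top t u => teval t |> teval u
  | tdiv t u => qdiv (teval t) (teval u)
  end.

Lemma teval_teq s t : teq s t -> teval s = teval t.
Proof.
elim=> //= [???? -> _ -> |????? -> _ -> |????? -> _ -> |?|??|??|???|????] //.
- exact: qopxx.
- exact: qdivK.
- exact: qopK.
- exact: qopD.
- exact: qopACA.
Qed.

Lemma free_lift_subproof (x y : free_aq) :
  teval (rep (x |> y)) = teval (rep x) |> teval (rep y).
Proof. by rewrite (teval_teq (rep_cls _ _)). Qed.

Definition free_lift : qhom free_aq X :=
  @QHom free_aq X (fun x => teval (rep x)) free_lift_subproof.

Lemma free_lift_gen s : free_lift (free_gen s) = f s.
Proof. exact: (teval_teq (rep_cls _ _)). Qed.

End Free.

Lemma free_hom_eq S (X : aquandle) (f g : qhom (free_aq S) X) :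
  (forall s, f (free_gen s) = g (free_gen s)) -> f =1 g.
Proof.
move=> fg; elim/free_ind; elim=> [s|s IHs t IHt|s IHs t IHt]; first exact: fg.
- have -> : free_cls (top s t) = (free_cls s : free_aq S) |> free_cls t.
    by rewrite /= free_opE.
  by rewrite !qfunM IHs IHt.
- apply: (@qopI _ (f (free_cls t))); rewrite {2}IHt -!qfunM.
  have -> : (free_cls (tdiv s t) : free_aq S) |> free_cls t = free_cls s.
    by rewrite /= free_opE; apply/clsP; apply: teq_divK.
  exact: IHs.
Qed.

(* Least congruence containing [r].  Compatibility with |> alone would not make
   right translations of the quotient injective, hence [cong_div]. *)
Inductive cong (X : quandle) (r : X -> X -> Prop) : X -> X -> Prop :=
  | cong_base x y : r x y -> cong r x y
  | cong_refl x : cong r x x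
  | cong_sym x y : cong r x y -> cong r y x
  | cong_trans x y z : cong r x y -> cong r y z -> cong r x z
  | cong_op x x' y y' : cong r x x' -> cong r y y' -> cong r (x |> y) (x' |> y')
  | cong_div x x' y y' : cong r (x |> y) (x' |> y') -> cong r y y' -> cong r x x'.

Lemma cong_equivalence (X : quandle) (r : X -> X -> Prop) : equivalence (cong r).
Proof.
by split; [apply: cong_refl|apply: cong_sym|apply: cong_trans].
Qed.

Section QuotAQ.
Variables (X : aquandle) (r : X -> X -> Prop).

Definition quot_car : Type := quot (cong_equivalence r).

Definition qcls : X -> quot_car := cls (cong_equivalence r).

Definition quot_op (x y : quot_car) : quot_car := qcls (rep x |> rep y).

Lemma quot_opE x y : quot_op (qcls x) (qcls y) = qcls (x |> y).
Proof. by apply/clsP; apply: cong_op; apply: rep_cls. Qed.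

Lemma quot_ind (P : quot_car -> Prop) : (forall x, P (qcls x)) -> forall y, P y.
Proof. by move=> Pc y; rewrite -(repK y); apply: Pc. Qed.

Lemma quot_opxx x : quot_op x x = x.
Proof. by elim/quot_ind: x => x; rewrite quot_opE qopxx. Qed.

Lemma quot_op_div x y : exists! z, x = quot_op z y.
Proof.
elim/quot_ind: x => x; elim/quot_ind: y => y; exists (qcls (qdiv x y)); split.
  by rewrite quot_opE qdivK.
elim/quot_ind => z; rewrite quot_opE => /clsP xz; apply/clsP.
apply: (@cong_div _ _ _ _ y y); last exact: cong_refl.
by rewrite qdivK.
Qed.

Lemma quot_opD x y z :
  quot_op (quot_op x y) z = quot_op (quot_op x z) (quot_op y z).
Proof.
elim/quot_ind: x => x; elim/quot_ind: y => y; elim/quot_ind: z => z.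
by rewrite !quot_opE qopD.
Qed.

Definition quot_quandle : quandle := Quandle quot_opxx quot_op_div quot_opD.

Lemma quot_opACA (x y z w : quot_quandle) :
  (x |> y) |> (z |> w) = (x |> z) |> (y |> w).
Proof.
elim/quot_ind: x => x; elim/quot_ind: y => y; elim/quot_ind: z => z.
by elim/quot_ind: w => w; rewrite /= !quot_opE qopACA.
Qed.

Definition quot_aq : aquandle := AQuandle quot_opACA.

Definition quot_proj : qhom X quot_aq :=
  @QHom X quot_aq qcls (fun x y => esym (quot_opE x y)).

Variables (Z : aquandle) (f : qhom X Z).
Hypothesis fr : forall x y, r x y -> f x = f y.

Lemma quot_lift_cong x y : cong r x y -> f x = f y.
Proof.
elim=> //= [???? -> _ -> |????? fx _ fy|????? fxy _ fy] //.
- by rewrite !qfunM fx fy.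
- by move: fxy; rewrite !qfunM fy => /qopI.
Qed.

Lemma quot_lift_subproof (x y : quot_aq) :
  f (rep (x |> y)) = f (rep x) |> f (rep y).
Proof. by rewrite -qfunM; apply: quot_lift_cong; apply: rep_cls. Qed.

Definition quot_lift : qhom quot_aq Z :=
  @QHom quot_aq Z (fun x => f (rep x)) quot_lift_subproof.

Lemma quot_lift_proj x : quot_lift (quot_proj x) = f x.
Proof. by apply: quot_lift_cong; apply: rep_cls. Qed.

End QuotAQ.

Inductive tensor_rel (Q A : aquandle) :
    free_aq (Q * A) -> free_aq (Q * A) -> Prop :=
  | tensor_relr q a1 a2 :
      tensor_rel (free_gen (q, a1) |> free_gen (q, a2)) (free_gen (q, a1 |> a2))
  | tensor_rell q1 q2 a :
      tensor_rel (free_gen (q1, a) |> free_gen (q2, a)) (free_gen (q1 |> q2, a)).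

Definition tensor (Q A : aquandle) : aquandle := quot_aq (@tensor_rel Q A).

Definition tens (Q A : aquandle) (q : Q) (a : A) : tensor Q A :=
  quot_proj (@tensor_rel Q A) (free_gen (q, a)).

Lemma tens_opr (Q A : aquandle) (q : Q) (a1 a2 : A) :
  tens q (a1 |> a2) = tens q a1 |> tens q a2.
Proof.
rewrite /tens -qfunM; apply/clsP; apply: cong_sym; apply: cong_base.
exact: tensor_relr.
Qed.

Lemma tens_opl (Q A : aquandle) (q1 q2 : Q) (a : A) :
  tens (q1 |> q2) a = tens q1 a |> tens q2 a.
Proof.
rewrite /tens -qfunM; apply/clsP; apply: cong_sym; apply: cong_base.
exact: tensor_rell.
Qed.

Section TensorLift.
Variables (Q A X : aquandle) (b : Q -> A -> X).
Hypothesis br : forall q a1 a2, b q (a1 |> a2) = b q a1 |> b q a2.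
Hypothesis bl : forall q1 q2 a, b (q1 |> q2) a = b q1 a |> b q2 a.

Lemma tensor_lift_subproof x y : tensor_rel x y ->
  free_lift (fun p : Q * A => b p.1 p.2) x = free_lift (fun p => b p.1 p.2) y.
Proof. by case=> *; rewrite qfunM !free_lift_gen /= ?br ?bl. Qed.

Definition tensor_lift : qhom (tensor Q A) X := quot_lift tensor_lift_subproof.

Lemma tensor_liftE q a : tensor_lift (tens q a) = b q a.
Proof. by rewrite /tensor_lift quot_lift_proj free_lift_gen. Qed.

End TensorLift.

Lemma tensor_hom_eq (Q A X : aquandle) (f g : qhom (tensor Q A) X) :
  (forall q a, f (tens q a) = g (tens q a)) -> f = g.
Proof.
move=> fg; apply: qhom_eq; elim/quot_ind => x.
pose p := quot_proj (@tensor_rel Q A).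
by apply: (@free_hom_eq _ _ (qhom_comp f p) (qhom_comp g p)) => -[q a]; apply: fg.
Qed.

Section TensorMap.
Variables (Q Q' A A' : aquandle) (f : qhom Q Q') (g : qhom A A').

Lemma tensor_map_r q a1 a2 :
  tens (f q) (g (a1 |> a2)) = tens (f q) (g a1) |> tens (f q) (g a2).
Proof. by rewrite qfunM tens_opr. Qed.

Lemma tensor_map_l q1 q2 a :
  tens (f (q1 |> q2)) (g a) = tens (f q1) (g a) |> tens (f q2) (g a).
Proof. by rewrite qfunM tens_opl. Qed.

Definition tensor_map : qhom (tensor Q A) (tensor Q' A') :=
  tensor_lift tensor_map_r tensor_map_l.

Lemma tensor_mapE q a : tensor_map (tens q a) = tens (f q) (g a).
Proof. exact: tensor_liftE. Qed.

End TensorMap.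

Record category := Category {
  ob :> Type;
  hom : ob -> ob -> Type;
  idc : forall a, hom a a;
  compc : forall a b c, hom b c -> hom a b -> hom a c;
  comp1f : forall a b (f : hom a b), compc (idc b) f = f;
  compf1 : forall a b (f : hom a b), compc f (idc a) = f;
  compA : forall a b c d (h : hom c d) (g : hom b c) (f : hom a b),
    compc h (compc g f) = compc (compc h g) f }.

Arguments idc {_} a.

Declare Scope cat_scope.
Delimit Scope cat_scope with Cat.
Local Open Scope cat_scope.
(* Diagrammatic order, as for functions in ssrfun. *)
Notation "f \; g" := (compc g f) : cat_scope.

Record functor (C D : category) := Functor {
  fob :> C -> D;
  fmap : forall a b, hom a b -> hom (fob a) (fob b);
  fmap1 : forall a, fmap (idc a) = idc (fob a);
  fmapM : forall a b c (g : hom b c) (f : hom a b),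
    fmap (f \; g) = fmap f \; fmap g }.

Section ProdCat.
Variables C D : category.

Definition phom (a b : C * D) : Type := (hom a.1 b.1 * hom a.2 b.2)%type.
Definition pid (a : C * D) : phom a a := (idc a.1, idc a.2).
Definition pcomp a b c (g : phom b c) (f : phom a b) : phom a c :=
  (f.1 \; g.1, f.2 \; g.2).

Lemma pcomp1f a b (f : phom a b) : pcomp (pid b) f = f.
Proof. by case: f => f g; rewrite /pcomp /= !comp1f. Qed.

Lemma pcompf1 a b (f : phom a b) : pcomp f (pid a) = f.
Proof. by case: f => f g; rewrite /pcomp /= !compf1. Qed.

Lemma pcompA a b c d (h : phom c d) (g : phom b c) (f : phom a b) :
  pcomp h (pcomp g f) = pcomp (pcomp h g) f.
Proof. by rewrite /pcomp /= !compA. Qed.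

Definition prod_cat : category := Category pcomp1f pcompf1 pcompA.

End ProdCat.

Section Bifunctor.
Variables (C D E : category) (T : functor (prod_cat C D) E).

Definition bimap a a' b b' (f : hom a a') (g : hom b b') :
    hom (T (a, b)) (T (a', b')) :=
  @fmap _ _ T (a, b) (a', b') (f, g).

Variable b : D.

Lemma partial1 a : bimap (idc a) (idc b) = idc (T (a, b)).
Proof. exact: (@fmap1 _ _ T (a, b)). Qed.

Lemma partialM a1 a2 a3 (g : hom a2 a3) (f : hom a1 a2) :
  bimap (f \; g) (idc b) = bimap f (idc b) \; bimap g (idc b).
Proof.
rewrite -{1}(comp1f (idc b)).
exact: (@fmapM _ _ T (a1, b) (a2, b) (a3, b) (g, idc b) (f, idc b)).
Qed.

Definition partial : functor C E := Functor partial1 partialM.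

End Bifunctor.

Definition inverse_pair (C : category) (a b : C) (f : hom a b) (g : hom b a) :=
  f \; g = idc a /\ g \; f = idc b.

Record symmetric_monoidal (C : category) (T : functor (prod_cat C C) C) (I : C) :=
SymmetricMonoidal {
  assoc : forall a b c, hom (T (T (a, b), c)) (T (a, T (b, c)));
  assocV : forall a b c, hom (T (a, T (b, c))) (T (T (a, b), c));
  lunit : forall a, hom (T (I, a)) a;
  lunitV : forall a, hom a (T (I, a));
  runit : forall a, hom (T (a, I)) a;
  runitV : forall a, hom a (T (a, I));
  braid : forall a b, hom (T (a, b)) (T (b, a));
  assocK : forall a b c, inverse_pair (assoc a b c) (assocV a b c);
  lunitK : forall a, inverse_pair (lunit a) (lunitV a);
  runitK : forall a, inverse_pair (runit a) (runitV a);
  assoc_nat : forall a b c a' b' c' (f : hom a a') (g : hom b b') (h : hom c c'),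
    assoc a b c \; bimap T f (bimap T g h)
    = bimap T (bimap T f g) h \; assoc a' b' c';
  lunit_nat : forall a a' (f : hom a a'),
    lunit a \; f = bimap T (idc I) f \; lunit a';
  runit_nat : forall a a' (f : hom a a'),
    runit a \; f = bimap T f (idc I) \; runit a';
  braid_nat : forall a b a' b' (f : hom a a') (g : hom b b'),
    braid a b \; bimap T g f = bimap T f g \; braid a' b';
  triangle : forall a b,
    assoc a I b \; bimap T (idc a) (lunit b) = bimap T (runit a) (idc b);
  pentagon : forall a b c d,
    assoc (T (a, b)) c d \; assoc a b (T (c, d))
    = bimap T (assoc a b c) (idc d) \; assoc a (T (b, c)) d
        \; bimap T (idc a) (assoc b c d);
  hexagon : forall a b c,
    assoc a b c \; braid a (T (b, c)) \; assoc b c a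
    = bimap T (braid a b) (idc c) \; assoc b a c \; bimap T (idc b) (braid a c);
  braid_sym : forall a b, braid a b \; braid b a = idc (T (a, b)) }.

Record adjunction (C D : category) (F : functor C D) (G : functor D C) :=
Adjunction {
  transp : forall a b, hom (F a) b -> hom a (G b);
  transp_bij : forall a b, bijective (@transp a b);
  transp_nat : forall a a' b b' (u : hom a' a) (f : hom (F a) b) (v : hom b b'),
    transp (fmap F u \; f \; v) = u \; transp f \; fmap G v }.

Lemma qhom_comp1f (X Y : aquandle) (f : qhom X Y) : qhom_comp (qhom_id Y) f = f.
Proof. exact: qhom_eq. Qed.

Lemma qhom_compf1 (X Y : aquandle) (f : qhom X Y) : qhom_comp f (qhom_id X) = f.
Proof. exact: qhom_eq. Qed.

Lemma qhom_compA (X Y Z W : aquandle)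
    (h : qhom Z W) (g : qhom Y Z) (f : qhom X Y) :
  qhom_comp h (qhom_comp g f) = qhom_comp (qhom_comp h g) f.
Proof. exact: qhom_eq. Qed.

Definition AbQnd : category :=
  @Category aquandle (fun X Y => qhom X Y) (fun X => qhom_id X)
    (fun X Y Z => @qhom_comp X Y Z) qhom_comp1f qhom_compf1 qhom_compA.

Lemma tensor_map1 (p : prod_cat AbQnd AbQnd) :
  tensor_map (qhom_id p.1) (qhom_id p.2) = qhom_id (tensor p.1 p.2).
Proof. by apply: tensor_hom_eq => q a; rewrite tensor_mapE. Qed.

Lemma tensor_mapM (p p' p'' : prod_cat AbQnd AbQnd)
    (g : hom p' p'') (f : hom p p') :
  tensor_map (qhom_comp g.1 f.1) (qhom_comp g.2 f.2)
  = qhom_comp (tensor_map g.1 g.2) (tensor_map f.1 f.2).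
Proof.
apply: tensor_hom_eq => q a; rewrite tensor_mapE.
rewrite -[RHS]/(tensor_map g.1 g.2 (tensor_map f.1 f.2 (tens q a))).
by rewrite !tensor_mapE.
Qed.

Definition tensor_functor : functor (prod_cat AbQnd AbQnd) AbQnd :=
  @Functor (prod_cat AbQnd AbQnd) AbQnd (fun p => tensor p.1 p.2)
    (fun p p' f => tensor_map f.1 f.2) tensor_map1 tensor_mapM.

Section HomFunctor.
Variable Q : aquandle.

Lemma hom_map_subproof (A B : aquandle) (g : qhom A B) (f h : hom_aq Q A) :
  qhom_comp g (f |> h) = (qhom_comp g f : hom_aq Q B) |> qhom_comp g h.
Proof. by apply: qhom_eq => q; apply: qfunM. Qed.

Definition hom_map (A B : aquandle) (g : qhom A B) :
    qhom (hom_aq Q A) (hom_aq Q B) :=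
  @QHom (hom_aq Q A) (hom_aq Q B) (fun f => qhom_comp g f) (hom_map_subproof g).

Lemma hom_map1 (A : AbQnd) : hom_map (qhom_id A) = qhom_id (hom_aq Q A).
Proof. by apply: qhom_eq => f; apply: qhom_eq. Qed.

Lemma hom_mapM (A B C : AbQnd) (g : hom B C) (f : hom A B) :
  hom_map (qhom_comp g f) = qhom_comp (hom_map g) (hom_map f).
Proof. by apply: qhom_eq => h; apply: qhom_eq. Qed.

Definition hom_functor : functor AbQnd AbQnd :=
  @Functor AbQnd AbQnd (fun A => hom_aq Q A) (fun A B => @hom_map A B)
    hom_map1 hom_mapM.

End HomFunctor.

(* Main.v *)
From mathcomp Require Import all_boot.
Require Import Defs.

(** Everything follows from the natural bijection between homomorphisms
    X (x) Y -> Z and homomorphisms X -> Hom(Y, Z), given by [curry] and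
    [uncurry]: both amount to maps X -> Y -> Z that are homomorphisms in each
    variable, the former by the presentation of the tensor product, the latter
    because the operation of Hom(Y, Z) is pointwise.  This bijection is the
    adjunction.

    It also produces the structure maps.  The unit isomorphisms and the braiding
    are lifts of bihomomorphisms; for the unit ones this uses a |> a = a, which
    makes constant maps homomorphisms.  For the associator one needs a map
    out of (X (x) Y) (x) Z that is known on the triples (x (x) y) (x) z only;
    since an element of X (x) Y need not be a pure tensor, it is obtained by
    lifting (x, y) |-> (z |-> x (x) (y (x) z)) to X (x) Y -> Hom(Z, _) and
    uncurrying.

    For the coherence diagrams, a homomorphism out of an iterated tensor
    product is determined by its values on iterated pure tensors:
    [tensor_hom_eq] settles two factors, and [tensor3_hom_eq],
    [tensor3r_hom_eq] and [tensor4_hom_eq] follow by currying.  Each diagram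
    then holds because both sides send pure tensors to the same rebracketed or
    permuted pure tensor. *)

Set Implicit Arguments.
Unset Strict Implicit.
Unset Printing Implicit Defensive.

Local Open Scope quandle_scope.

(** A composite in the category of abelian quandles has this left-hand side only
    up to conversion, so rewriting with the lemma names the place where a
    composite is to be unfolded. *)
Lemma qhom_compE (X Y Z : quandle) (g : qhom Y Z) (f : qhom X Y) x :
  qhom_comp g f x = g (f x).
Proof. by []. Qed.

(** * Currying *)

Section Curry.
Variables X Y Z : aquandle.

Definition tensr (x : X) : qhom Y (tensor X Y) := QHom (@tens_opr X Y x).

Lemma curry_subproof (f : qhom (tensor X Y) Z) x1 x2 :
  qhom_comp f (tensr (x1 |> x2))
  = (qhom_comp f (tensr x1) : hom_aq Y Z) |> qhom_comp f (tensr x2).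
Proof.
apply: qhom_eq => y.
by rewrite -[LHS]/(f (tens (x1 |> x2) y)) tens_opl qfunM.
Qed.

Definition curry (f : qhom (tensor X Y) Z) : qhom X (hom_aq Y Z) :=
  @QHom X (hom_aq Y Z) (fun x => qhom_comp f (tensr x)) (curry_subproof f).

Lemma curryE f x y : (curry f x : qhom Y Z) y = f (tens x y).
Proof. by []. Qed.

Section Uncurry.
Variable g : qhom X (hom_aq Y Z).

Let b (x : X) : qhom Y Z := g x.

Lemma uncurry_r x y1 y2 : b x (y1 |> y2) = b x y1 |> b x y2.
Proof. exact: qfunM. Qed.

Lemma uncurry_l x1 x2 y : b (x1 |> x2) y = b x1 y |> b x2 y.
Proof. by rewrite /b qfunM. Qed.

Definition uncurry : qhom (tensor X Y) Z := tensor_lift uncurry_r uncurry_l.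

Lemma uncurryE x y : uncurry (tens x y) = (g x : qhom Y Z) y.
Proof. exact: tensor_liftE. Qed.

End Uncurry.

Lemma curryK : cancel curry uncurry.
Proof. by move=> f; apply: tensor_hom_eq => x y; rewrite uncurryE curryE. Qed.

Lemma uncurryK : cancel uncurry curry.
Proof.
move=> g; apply: qhom_eq => x; apply: qhom_eq => y.
by rewrite curryE uncurryE.
Qed.

End Curry.

(** * Homomorphisms out of iterated tensor products *)

(** The pure tensors x (x) y need not exhaust X (x) Y, so [tensor_hom_eq] cannot
    be used twice in a row; currying Z away first leaves a comparison of
    homomorphisms out of X (x) Y alone. *)
Lemma tensor3_hom_eq (X Y Z W : aquandle)
    (f g : qhom (tensor (tensor X Y) Z) W) :
  (forall x y z, f (tens (tens x y) z) = g (tens (tens x y) z)) -> f = g.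
Proof.
move=> fg; apply: (can_inj (@curryK _ _ _)).
by apply: tensor_hom_eq => x y; apply: qhom_eq => z; rewrite !curryE.
Qed.

Lemma tensor3r_hom_eq (X Y Z W : aquandle)
    (f g : qhom (tensor X (tensor Y Z)) W) :
  (forall x y z, f (tens x (tens y z)) = g (tens x (tens y z))) -> f = g.
Proof.
move=> fg; apply: (can_inj (@curryK _ _ _)).
by apply: qhom_eq => x; apply: tensor_hom_eq => y z; rewrite !curryE.
Qed.

Lemma tensor4_hom_eq (X Y Z U W : aquandle)
    (f g : qhom (tensor (tensor (tensor X Y) Z) U) W) :
  (forall x y z u, f (tens (tens (tens x y) z) u)
                 = g (tens (tens (tens x y) z) u)) -> f = g.
Proof.
move=> fg; apply: (can_inj (@curryK _ _ _)).
by apply: tensor3_hom_eq => x y z; apply: qhom_eq => u; rewrite !curryE.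
Qed.

(** * The structure maps *)

Section Associator.
Variables X Y Z : aquandle.

(** On (X (x) Y) (x) Z only the values on triples are prescribed, so the map is
    first defined on X (x) Y, with values in Hom(Z, X (x) (Y (x) Z)). *)
Definition tassoc : qhom (tensor (tensor X Y) Z) (tensor X (tensor Y Z)).
Proof.
pose b (x : X) (y : Y) : hom_aq Z (tensor X (tensor Y Z)) :=
  qhom_comp (tensr (tensor Y Z) x) (tensr Z y).
apply: uncurry; apply: (@tensor_lift X Y _ b) => [x y1 y2|x1 x2 y].
- by apply: qhom_eq => z; rewrite /= tens_opl tens_opr.
- by apply: qhom_eq => z; rewrite /= tens_opl.
Defined.

Lemma tassocE x y z : tassoc (tens (tens x y) z) = tens x (tens y z).
Proof. by rewrite uncurryE tensor_liftE. Qed.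

(** For each x this is y (x) z |-> (x (x) y) (x) z on Y (x) Z, the functor
    - (x) Z applied to y |-> x (x) y; what is left to check is that it is a
    homomorphism in x. *)
Definition tassocV : qhom (tensor X (tensor Y Z)) (tensor (tensor X Y) Z).
Proof.
pose b (x : X) : qhom (tensor Y Z) (tensor (tensor X Y) Z) :=
  tensor_map (tensr Y x) (qhom_id Z).
apply: (@uncurry X (tensor Y Z) _ (@QHom X (hom_aq _ _) b _)) => x1 x2.
apply: tensor_hom_eq => y z.
rewrite -[RHS]/(b x1 (tens y z) |> b x2 (tens y z)) !tensor_mapE /=.
by rewrite !tens_opl.
Defined.

Lemma tassocVE x y z : tassocV (tens x (tens y z)) = tens (tens x y) z.
Proof. by rewrite uncurryE [LHS]tensor_mapE. Qed.

End Associator.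

Section UnitsAndBraiding.
Variables X Y : aquandle.

Definition tlunit : qhom (tensor unit_aq X) X :=
  @tensor_lift unit_aq X X (fun _ x => x)
    (fun _ _ _ => erefl) (fun _ _ x => esym (qopxx x)).

Lemma tlunitE u x : tlunit (tens u x) = x.
Proof. exact: tensor_liftE. Qed.

Definition tlunitV : qhom X (tensor unit_aq X) := tensr X (tt : unit_aq).

Definition trunit : qhom (tensor X unit_aq) X :=
  @tensor_lift X unit_aq X (fun x _ => x)
    (fun x _ _ => esym (qopxx x)) (fun _ _ _ => erefl).

Lemma trunitE x u : trunit (tens x u) = x.
Proof. exact: tensor_liftE. Qed.

Definition trunitV : qhom X (tensor X unit_aq) :=
  @QHom X (tensor X unit_aq) (fun x => tens x (tt : unit_aq))
    (fun x1 x2 => tens_opl x1 x2 (tt : unit_aq)).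

Definition tbraid : qhom (tensor X Y) (tensor Y X) :=
  @tensor_lift X Y (tensor Y X) (fun x y => tens y x)
    (fun x y1 y2 => tens_opl y1 y2 x) (fun x1 x2 y => tens_opr y x1 x2).

Lemma tbraidE x y : tbraid (tens x y) = tens y x.
Proof. exact: tensor_liftE. Qed.

End UnitsAndBraiding.

Definition tensorE :=
  (tassocE, tassocVE, tlunitE, trunitE, tbraidE, tensor_mapE).

(** * The symmetric monoidal structure and the adjunction *)

Definition tensor_symmetric_monoidal :
  @symmetric_monoidal AbQnd tensor_functor unit_aq.
Proof.
apply: (@SymmetricMonoidal AbQnd tensor_functor unit_aq
  tassoc tassocV tlunit tlunitV trunit trunitV tbraid).
- move=> X Y Z; split.
  + by apply: tensor3_hom_eq => x y z; rewrite [LHS]qhom_compE !tensorE.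
  + by apply: tensor3r_hom_eq => x y z; rewrite [LHS]qhom_compE !tensorE.
- move=> X; split.
  + by apply: tensor_hom_eq => -[] x; rewrite [LHS]qhom_compE tensorE.
  + by apply: qhom_eq => x; rewrite [LHS]qhom_compE tensorE.
- move=> X; split.
  + by apply: tensor_hom_eq => x []; rewrite [LHS]qhom_compE tensorE.
  + by apply: qhom_eq => x; rewrite [LHS]qhom_compE tensorE.
- move=> X Y Z X' Y' Z' f g h; apply: tensor3_hom_eq => x y z.
  by rewrite [LHS]qhom_compE [RHS]qhom_compE !tensorE.
- move=> X X' f; apply: tensor_hom_eq => u x.
  by rewrite [LHS]qhom_compE [RHS]qhom_compE !tensorE.
- move=> X X' f; apply: tensor_hom_eq => x u.
  by rewrite [LHS]qhom_compE [RHS]qhom_compE !tensorE.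
- move=> X Y X' Y' f g; apply: tensor_hom_eq => x y.
  by rewrite [LHS]qhom_compE [RHS]qhom_compE !tensorE.
- move=> X Y; apply: tensor3_hom_eq => x u y.
  by rewrite [LHS]qhom_compE !tensorE.
- move=> X Y Z U; apply: tensor4_hom_eq => x y z u.
  by rewrite [LHS]qhom_compE [RHS]qhom_compE [in RHS]qhom_compE !tensorE.
- move=> X Y Z; apply: tensor3_hom_eq => x y z.
  rewrite [LHS]qhom_compE [RHS]qhom_compE.
  by rewrite [in LHS]qhom_compE [in RHS]qhom_compE !tensorE.
- move=> X Y; apply: tensor_hom_eq => x y.
  by rewrite [LHS]qhom_compE !tensorE.
Qed.

Definition tensor_hom_adjunction (Q : AbQnd) :
  adjunction (partial tensor_functor Q) (hom_functor Q).
Proof.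
apply: (@Adjunction AbQnd AbQnd (partial tensor_functor Q) (hom_functor Q)
  (fun X Z => @curry X Q Z)).
- by move=> X Z; exists (@uncurry X Q Z); [apply: curryK|apply: uncurryK].
- move=> X X' Z Z' u f v; apply: qhom_eq => x; apply: qhom_eq => q.
  by rewrite curryE [LHS]qhom_compE [in LHS]qhom_compE tensor_mapE.
Qed.

Theorem theorem12 :
  inhabited (@symmetric_monoidal AbQnd tensor_functor unit_aq) /\
  (forall Q : AbQnd,
     inhabited (adjunction (partial tensor_functor Q) (hom_functor Q))).
Proof.
split; first exact: inhabits tensor_symmetric_monoidal.
by move=> Q; apply: inhabits; apply: tensor_hom_adjunction.
Qed.
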